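(* Let $\eta\in(0,1)$ be fixed, and let $k$ and $r$ be non-negative integers with $k\ge 2$. Let $P$ be sufficiently large in terms of $\eta$, $k$ and $r$. Suppose that $\mathbf h\in\mathbb Z^k$ is a coefficient $k$-tuple having the property that $$U_{k+1,k}(P;\mathbf h)>P^{r+\eta}.\qquad ( * )$$ Then one has $0\le r\le (k-1)/2$, and for some integers $a_i$ with $|a_i|\le P$ $(1\le i\le k-1-2r)$, one has $$h_j=a_1^{2j-1}+\ldots+a_{k-1-2r}^{2j-1}\quad (1\le j\le k).$$ In particular, when $r$ is the largest integer for which the lower bound $( * )$ holds for some $\eta\in(0,1)$, then for every $\varepsilon>0$, we have $$P^{r+1}\ll U_{k+1,k}(P;\mathbf h)\ll P^{r+1+\varepsilon}.$$
   Context: $P$ denotes a large positive integer. For natural numbers $s$ and $k$, and $\mathbf h=(h_1,\ldots,h_k)\in\mathbb Z^k$, $U_{s,k}(P;\mathbf h)$ denotes the number of integral solutions $(x_1,\ldots,x_s)$ of the system $$\sum_{i=1}^s x_i^{2j-1}=h_j\quad (1\le j\le k),$$ with $|x_i|\le P$ $(1\le i\le s)$. *)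

(* Defs.v *)
From HB Require Import structures.
From mathcomp Require Import all_boot all_order all_algebra.
From mathcomp Require Import all_classical all_reals all_analysis.

Set Implicit Arguments.
Unset Strict Implicit.
Unset Printing Implicit Defensive.

Import Order.TTheory GRing.Theory Num.Theory.

Local Open Scope ring_scope.

(* The ordinal t < 2P + 1 encodes the integer t - P of the interval [-P, P]. *)
Definition box_int (P : nat) (t : 'I_(2 * P).+1) : int := t%:Z - P%:Z.

Lemma box_int_inj (P : nat) : injective (@box_int P).
Proof. by move=> s t /addIr [] /val_inj. Qed.

Lemma box_intP (P : nat) (m : int) :
  reflect (exists t : 'I_(2 * P).+1, m = box_int t) (`|m| <= P%:Z).
Proof.
apply: (iffP idP) => [|[t ->]]; rewrite /box_int ler_norml.
  case/andP=> lo hi.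
  have m0 : 0 <= m + P%:Z by rewrite -lerBlDr sub0r.
  have lt_m : (`|(m + P%:Z)%R|%N < (2 * P).+1)%N.
    by rewrite ltnS -lez_nat gez0_abs // mul2n -addnn PoszD lerD2r.
  by exists (Ordinal lt_m); rewrite /= gez0_abs // addrK.
rewrite lerBrDr addNr lez_nat leq0n /= lerBlDr -PoszD lez_nat addnn -mul2n.
by rewrite -ltnS ltn_ord.
Qed.

(* Indices start at 0 here, so the j-th equation has degree 2j + 1. *)
Definition U (s k P : nat) (h : 'I_k -> int) : nat :=
  #|[set x : {ffun 'I_s -> 'I_(2 * P).+1} |
      [forall j : 'I_k,
        \sum_(i < s) box_int (x i) ^+ (2 * j).+1 == h j]]|.

(* Main.v *)
Require Import Defs.
From HB Require Import structures.
From mathcomp Require Import all_boot all_order all_algebra.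
From mathcomp Require Import all_classical all_reals all_analysis.
From mathcomp Require Import zify ring.

Set Implicit Arguments.
Unset Strict Implicit.
Unset Printing Implicit Defensive.

Import Order.TTheory GRing.Theory Num.Theory.

Local Open Scope ring_scope.

(** Two solutions x, y have the same odd power sums of degree at most 2k - 1, so
    by Newton's identities the polynomial F(X) = prod (X - x_i) prod (X + y_i) of
    degree 2k + 2 satisfies F(X) - F(-X) = 2 e X for a constant e.  Evaluating at
    the roots gives prod_{j <> i} (x_i + x_j) prod_j (x_i - y_j) = -e for every i,
    and the same up to sign with x and y exchanged.  If e <> 0, multiplying over i shows that
    D(x) = prod_{i <> j} (x_i + x_j) is nonzero and |D(x)| = |D(y)|; the sums
    y_i + y_j are then divisors of a fixed integer, so there are O(P^eps) such y.
    If e = 0, the multiset of the x_i and -y_i is symmetric, so that x and y have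
    the same core a, what is left after deleting pairs (b, -b).  Hence either the
    number of solutions is O(P^eps), or the solutions are exactly the arrangements
    of a, b, -b with b in a box of dimension m, and their number has order P^m. *)

(** * Newton's identities and the odd part of a product of linear factors *)

Lemma deriv_prod_XsubC (R : comNzRingType) (I : finType) (P : pred I) (z : I -> R) :
  (\prod_(i | P i) ('X - (z i)%:P))^`() =
  \sum_(i | P i) \prod_(j | P j && (j != i)) ('X - (z j)%:P).
Proof.
have [n] := ubnP #|P|; elim: n P => // n IH P lePn.
have [i Pi|P0] := pickP P; last by rewrite !big_pred0 // derivC.
rewrite (bigD1 i) //= derivM derivXsubC mul1r [RHS](bigD1 i) //=.
congr (_ + _); rewrite IH; last first.
  rewrite -ltnS; apply: leq_trans lePn; rewrite ltnS (cardD1 i P) -topredE /= Pi ltnS.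
  by apply: subset_leq_card; apply/fintype.subsetP => j; rewrite !inE andbC.
rewrite big_distrr; apply: eq_bigr => j /andP[Pj ji].
rewrite [RHS](bigD1 i) /=; last by rewrite Pi eq_sym.
by congr (_ * _); apply: eq_bigl => l; rewrite -!andbA [X in _ && X]andbC.
Qed.

Section OddPowerSums.

Variables (R : numDomainType) (I : finType) (z : I -> R).

Local Notation F := (\prod_i ('X - (z i)%:P)).
Local Notation F_ i := (\prod_(j | j != i) ('X - (z j)%:P)).

Lemma coef_prod_XsubC_gt m : (#|I| < m)%N -> F`_m = 0.
Proof.
by move=> ltIm; rewrite nth_default // -big_enum size_prod_XsubC -cardE.
Qed.

(** Comparing coefficients in [F = (X - z i) F_i] gives a one-step recursion for those of [F_i];
    after [#|I|] steps the remainder lies beyond the degree of [F_i]. *)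
Lemma coef_prod_XsubC_neq i m :
  (F_ i)`_m = \sum_(l < #|I|) F`_(m.+1 + l) * z i ^+ l.
Proof.
have step p : (F_ i)`_p = F`_p.+1 + z i * (F_ i)`_p.+1.
  by rewrite [F](bigD1 i) //= mulrBl coefB coefXM coefCM /= addrNK.
have iter L : (F_ i)`_m =
    \sum_(l < L) F`_(m.+1 + l) * z i ^+ l + z i ^+ L * (F_ i)`_(m + L).
  elim: L => [|L {1}->]; first by rewrite big_ord0 add0r mul1r addn0.
  by rewrite big_ord_recr /= -addrA step exprSr addnS; congr (_ + _); ring.
rewrite (iter #|I|) [X in _ + _ * X]nth_default ?mulr0 ?addr0 //.
have -> : F_ i = \prod_(j <- enum (predC1 i)) ('X - (z j)%:P) by rewrite big_enum.
by rewrite size_prod_XsubC -cardE cardC1 prednK ?leq_addl // (cardD1 i).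
Qed.

Lemma Newton_prod_XsubC q : (0 < q)%N ->
  F`_q *+ q = \sum_(l < #|I|) F`_(q + l) * \sum_i z i ^+ l.
Proof.
case: q => // q _; rewrite -coef_deriv deriv_prod_XsubC coef_sum.
transitivity (\sum_i \sum_(l < #|I|) F`_(q.+1 + l) * z i ^+ l).
  by apply: eq_bigr => i _; rewrite -coef_prod_XsubC_neq.
by rewrite exchange_big; apply: eq_bigr => l _; rewrite mulr_sumr.
Qed.

Hypothesis even_I : ~~ odd #|I|.
Hypothesis odd_sums : forall l, odd l -> (l.+2 < #|I|)%N -> \sum_i z i ^+ l = 0.

(** Descending induction on [q]. In Newton's identity an even [l > 0] gives the higher odd index
    [q + l]; an odd [l] has zero power sum, or [q + l > #|I|] because [q > 2]. What remains is
    [F_q * (#|I| - q) = 0], where [q] differs from [#|I|] by parity. *)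
Lemma odd_coef_prod_XsubC q : odd q -> (2 < q)%N -> F`_q = 0.
Proof.
have [n] := ubnP (#|I|.+1 - q)%N; elim: n q => // n IH q leqn oddq gt2q.
have [ltIq|leqI] := ltnP #|I| q; first exact: coef_prod_XsubC_gt.
have ltqI : (q < #|I|)%N by rewrite ltn_neqAle leqI andbT; apply: contraTneq oddq => ->.
have := Newton_prod_XsubC (ltn_trans (isT : (0 < 2)%N) gt2q).
have I0 : (0 < #|I|)%N by apply: leq_trans ltqI.
rewrite [X in _ = X](bigD1 (Ordinal I0)) //= addn0 [X in _ + X]big1 => [|l]; last first.
  rewrite -val_eqE /= => l0.
  have [oddl|evenl] := boolP (odd l).
    have [ltl|gel] := ltnP l.+2 #|I|; first by rewrite odd_sums ?mulr0.
    by rewrite coef_prod_XsubC_gt ?mul0r //; lia.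
  rewrite IH ?mul0r //; last by lia.
    by move: leqn l0 leqI; lia.
  by rewrite oddD oddq (negbTE evenl).
rewrite [X in _ * X](eq_bigr (fun=> 1)) ?sumr_const ?addr0 ?mulr_natr => [/eqP|//].
rewrite -subr_eq0 -opprB oppr_eq0 -mulrnBr //.
by rewrite mulrn_eq0 subn_eq0 leqNgt ltqI => /eqP.
Qed.

Lemma prod_XsubC_odd_part : F - (F \Po - 'X) = (F`_1 *+ 2) *: 'X.
Proof.
apply/polyP => m.
rewrite coefB coefZ coefX.
have -> : (F \Po - 'X)`_m = (-1) ^+ m * F`_m.
  rewrite comp_polyE coef_sum.
  under [LHS]eq_bigr do
    rewrite exprNn -signr_odd mulr_sign -scaler_sign signr_odd scalerA coefZ coefXn.
  have [lt|ge] := ltnP m (size F).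
    rewrite [LHS](bigD1 (Ordinal lt)) //= eqxx mulr1 [X in _ + X]big1 ?addr0 1?mulrC // => i.
    by rewrite -val_eqE eq_sym /= => /negbTE ->; rewrite mulr0.
  rewrite [LHS]big1 ?[F`_m]nth_default ?mulr0 // => i _.
  by case: eqP => [mi|_]; [move: (ltn_ord i); rewrite -mi ltnNge ge | rewrite mulr0].
rewrite -signr_odd; have [oddm|evenm] := boolP (odd m); last first.
  by rewrite mul1r subrr; case: eqP evenm => [->|]; rewrite ?mulr0.
rewrite mulN1r opprK -mulr2n.
have [->|m1] := eqVneq m 1%N; first by rewrite mulr1.
by rewrite odd_coef_prod_XsubC ?mul0rn ?mulr0 //; move: m m1 oddm => [|[|[|]]].
Qed.

Lemma prod_sum_roots i : \prod_(j | j != i) (- z i - z j) = F`_1.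
Proof.
have hornerF_ x : (F_ i).[x] = \prod_(j | j != i) (x - z j).
  by rewrite horner_prod; apply: eq_bigr => j _; rewrite !hornerE.
rewrite -hornerF_.
have := prod_XsubC_odd_part; rewrite {1 2}[F](bigD1 i) //= => eqF.
(* Evaluating at [z i] leaves a common factor [2 z i] to cancel; for a zero root the coefficients of
   [X] are compared instead. *)
have [zi0|zi0] := eqVneq (z i) 0.
  have /polyP/(_ 1%N) := eqF; rewrite zi0 subr0.
  rewrite coefB comp_polyM comp_polyX coefZ coefX mulr1 mulNr coefN opprK.
  rewrite !coefXM /= -!horner_coef0 horner_comp !hornerE oppr0 -mulr2n.
  by move=> /eqP; rewrite eqr_pMn2r // => /eqP.
have := congr1 (horner^~ (z i)) eqF.
rewrite /= hornerD hornerN horner_comp hornerM !hornerE subrr mul0r sub0r.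
rewrite -opprD mulNr opprK -mulr2n !mulrnAl [F`_1 * _]mulrC -mulrnAr -mulrnAr.
by move=> /(mulfI zi0)/eqP; rewrite eqr_pMn2r // => /eqP.
Qed.

End OddPowerSums.

(** * The divisor bound *)

(** Both sides are compared with [(e + K) ^_ K = K! * C(e + K, K)]. This is the cost of one small
    prime: [2 ^ e] is absorbed by [p ^ e], the rest is constant. *)
Lemma expSn_leq_exp2 (K e : nat) : (e.+1 ^ K <= K`! * 2 ^ K * 2 ^ e)%N.
Proof.
have le_ffact : (e.+1 ^ K <= (e + K) ^_ K)%N.
  elim: K => // K IH; rewrite addnS ffactSS expnS leq_mul //.
  by rewrite ltnS leq_addr.
have le_bin n m : ('C(n, m) <= 2 ^ n)%N.
  elim: n m => [|n IH] [|m]; rewrite ?bin0 ?expn_gt0 // binS expnS mul2n -addnn.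
  by rewrite leq_add.
apply: leq_trans le_ffact _; rewrite -bin_ffact mulnC -mulnA leq_mul //.
by rewrite -expnD addnC.
Qed.

(** A divisor is recovered from its p-adic valuation and its part prime to [p]. *)
Lemma size_divisors_partn (p n : nat) : prime p -> (0 < n)%N ->
  (size (divisors n) <= (logn p n).+1 * size (divisors n`_p^'))%N.
Proof.
move=> pr_p n0; rewrite -[X in (X * _)%N](size_iota 0).
rewrite -(size_allpairs (fun i d => p ^ i * d)%N) uniq_leq_size ?divisors_uniq // => d.
rewrite -dvdn_divisors // => dvd_dn.
have d0 : (0 < d)%N by apply: dvdn_gt0 dvd_dn.
apply/allpairsP; exists (logn p d, d`_p^')%N; split => /=.
- by rewrite -/(iota 0 _.+1) mem_iota ltnS dvdn_leq_log.
- by rewrite -dvdn_divisors ?part_gt0 // partn_dvd.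
- by rewrite -p_part partnC.
Qed.

(* A prime p >= 2 ^ K has (e + 1) ^ K <= p ^ e, so only the primes
   below 2 ^ K cost a constant factor. *)
Lemma divisors_bound_primes (K : nat) (s : seq nat) (n : nat) :
  (0 < n)%N -> {subset primes n <= s} -> all prime s ->
  (size (divisors n) ^ K <=
     (K`! * 2 ^ K) ^ count (fun p => p < 2 ^ K)%N s * n)%N.
Proof.
elim: s n => [|p s IH] n n0 sub_s.
  have -> : n = 1%N.
    by apply/eqP; rewrite eqn_leq n0 andbT leqNgt; apply/negP => n1;
      have := sub_s (pdiv n); rewrite mem_primes pdiv_prime // pdiv_dvd n0 => /(_ isT).
  by rewrite exp1n.
case/andP=> pr_p pr_s; have IHp := IH _ (part_gt0 p^' n).
apply: (@leq_trans ((logn p n).+1 ^ K * size (divisors n`_p^') ^ K)).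
  by rewrite -expnMn; case: (K) => // ?; rewrite leq_exp2r // size_divisors_partn.
rewrite -[X in (_ <= _ * X)%N](partnC p n0) p_part expnD mulnACA leq_mul //; last first.
  apply: IHp pr_s => q; rewrite primes_part mem_filter !inE => /andP[qp /sub_s].
  by rewrite inE (negbTE qp).
rewrite /=; case: ltnP => [_|lep]; last first.
  rewrite expn0 mul1n; apply: (@leq_trans ((2 ^ logn p n) ^ K)).
    by case: (K) => // ?; rewrite leq_exp2r // ltn_expl.
  by rewrite -expnM mulnC expnM; case: (logn p n) => // ?; rewrite leq_exp2r.
rewrite expn1 (leq_trans (expSn_leq_exp2 _ _)) // leq_mul //.
by case: (logn p n) => // ?; rewrite leq_exp2r ?prime_gt1.
Qed.

(** This is the classical d(n) = O(n^eps) with eps = 1/K, in a form free of roots. *)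
Lemma divisors_bound (K : nat) :
  exists2 B : nat, (0 < B)%N &
    forall n : nat, (0 < n)%N -> (size (divisors n) ^ K <= B * n)%N.
Proof.
(* At most [2 ^ K] primes lie below [2 ^ K], and each costs a factor [K! * 2 ^ K]. *)
exists ((K`! * 2 ^ K) ^ (2 ^ K))%N.
  by rewrite expn_gt0 muln_gt0 fact_gt0 expn_gt0.
move=> n n0; apply: leq_trans (@divisors_bound_primes K (primes n) n n0 (fun=> id) _) _.
  by apply/allP => p; rewrite mem_primes => /andP[].
rewrite leq_mul2r leq_pexp2l ?orbT ?muln_gt0 ?fact_gt0 ?expn_gt0 //.
rewrite -size_filter -[X in (_ <= X)%N](size_iota 0) uniq_leq_size ?filter_uniq ?primes_uniq //.
by move=> p; rewrite mem_filter mem_iota => /andP[].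
Qed.

(** * Comparison of two solutions *)

Lemma prod_XsubC_int_eq (s t : seq int) :
  \prod_(x <- s) ('X - x%:P) = \prod_(x <- t) ('X - x%:P) -> perm_eq s t.
Proof.
move=> /(congr1 (map_poly (intr : int -> rat))).
have map_prod u : map_poly (intr : int -> rat) (\prod_(x <- u) ('X - x%:P)) =
    \prod_(x <- map intr u) ('X - x%:P).
  by rewrite map_prod_XsubC big_map.
by rewrite !map_prod => /prod_XsubC_eq; apply: perm_map_inj; exact: intr_inj.
Qed.

(** The quantity D(x); it vanishes exactly when entries at two distinct indices are opposite. *)
Definition pair_sum_prod (n : nat) (x : 'I_n -> int) : int :=
  \prod_i \prod_(j | j != i) (x i + x j).

(** For [s], [t] the values of two solutions, the entries of [s ++ map -%R t] are the roots of F,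
    and the relation says that F is even. *)
Definition odd_equiv (s t : seq int) :=
  perm_eq (s ++ map -%R t) (map -%R s ++ t).

Section TwoSolutions.

Variables (k : nat) (x y : 'I_k.+1 -> int).
Hypothesis eq_sums : forall j : nat, (j < k)%N ->
  \sum_i x i ^+ (2 * j).+1 = \sum_i y i ^+ (2 * j).+1.

Let z (i : 'I_k.+1 + 'I_k.+1) : int :=
  match i with inl a => x a | inr a => - y a end.

Let even_I : ~~ odd #|{: 'I_k.+1 + 'I_k.+1}|.
Proof. by rewrite card_sum card_ord addnn odd_double. Qed.

Let odd_sums l : odd l -> (l.+2 < #|{: 'I_k.+1 + 'I_k.+1}|)%N ->
  \sum_i z i ^+ l = 0.
Proof.
rewrite card_sum card_ord => oddl ltl.
have -> : l = (2 * l./2).+1 by rewrite -{1}[l]odd_double_half oddl mul2n.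
rewrite big_sumType /= eq_sums; last by move: (odd_double_half l); rewrite oddl; lia.
rewrite -big_split big1 // => i _ /=.
by rewrite exprNn -signr_odd /= mul2n odd_double mulN1r subrr.
Qed.

Let e := (\prod_i ('X - (z i)%:P))`_1.

Lemma odd_equiv_of_coef1_eq0 : e = 0 -> odd_equiv (codom x) (codom y).
Proof.
move=> e0; have := prod_XsubC_odd_part even_I odd_sums.
rewrite -/e e0 mul0rn scale0r => /eqP; rewrite subr_eq0 => /eqP eqF.
have neg : \prod_i ('X - (z i)%:P) = \prod_i ('X - (- z i)%:P).
  rewrite {}eqF rmorph_prod /=.
  transitivity (\prod_i (- ('X - (- z i)%:P))).
    by apply: eq_bigr => i _; rewrite comp_polyB comp_polyX comp_polyC polyCN opprD opprK.
  by rewrite prodrN cardT -cardE -signr_odd (negbTE even_I) mul1r.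
apply: prod_XsubC_int_eq; move: neg.
rewrite !big_sumType /= !big_cat !big_map /= -!enumT !big_enum /= => ->.
by congr (_ * _); apply: eq_bigr => i _; rewrite opprK.
Qed.

(** Stated for arbitrary [x0], [y0] so that it serves both for (x, y) and for (y, x). *)
Lemma pair_sum_prod_coef1 (x0 y0 : 'I_k.+1 -> int) :
  (forall a, \prod_(b | b != a) `|x0 a + x0 b| * \prod_b `|x0 a - y0 b| = `|e|) ->
  `|pair_sum_prod x0| * \prod_a \prod_b `|x0 a - y0 b| = `|e| ^+ k.+1.
Proof.
move=> He; rewrite -[X in _ ^+ X]card_ord -prodr_const.
rewrite -[RHS](eq_bigr _ (fun a _ => He a)).
by rewrite big_split /= normr_prod; under eq_bigr do rewrite normr_prod.
Qed.

Lemma odd_equiv_or_pair_sum_prod :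
  odd_equiv (codom x) (codom y) \/
  [/\ pair_sum_prod x != 0, pair_sum_prod y != 0 &
      `|pair_sum_prod x| = `|pair_sum_prod y|].
Proof.
have [e0|e0] := eqVneq e 0; [by left; exact: odd_equiv_of_coef1_eq0|right].
have rootP := prod_sum_roots even_I odd_sums.
have Hx : `|pair_sum_prod x| * \prod_a \prod_b `|x a - y b| = `|e| ^+ k.+1.
  apply: pair_sum_prod_coef1 => a; rewrite /e -(rootP (inl a)) big_sumType normrM /= !normr_prod.
  congr (_ * _); apply: eq_big => // b; rewrite ?/z //= => _.
    by rewrite -opprD normrN.
  by rewrite -opprD normrN.
have Hy : `|pair_sum_prod y| * \prod_a \prod_b `|y a - x b| = `|e| ^+ k.+1.
  apply: pair_sum_prod_coef1 => a; rewrite /e -(rootP (inr a)) big_sumType normrM /=.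
  rewrite !normr_prod mulrC.
  by congr (_ * _); apply: eq_big => // b; rewrite ?/z //= => _; rewrite !opprK.
(* The mixed product is symmetric in x and y and nonzero because [e] is, so it cancels from [Hx] and
   [Hy]. *)
have swap : \prod_a \prod_b `|y a - x b| = \prod_a \prod_b `|x a - y b|.
  by rewrite exchange_big; do 2!apply: eq_bigr => ? _; rewrite distrC.
have en0 : `|e| ^+ k.+1 != 0 by rewrite expf_neq0 // normr_eq0.
rewrite swap in Hy; have := en0; rewrite -{1}Hx mulf_eq0 normr_eq0 => /norP[Dx M0].
split => //; first by move: en0; rewrite -Hy mulf_eq0 normr_eq0 => /norP[].
by apply: (mulIf M0); rewrite Hx Hy.
Qed.

End TwoSolutions.

(** * Cores: deleting opposite pairs *)

(** At [v = 0] this forbids two zeros but allows a single one. *)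
Definition pair_free (s : seq int) := forall v t, ~ perm_eq s [:: v, - v & t].

Lemma pair_free_decomposition (s : seq int) :
  exists a b, perm_eq s (a ++ b ++ map -%R b) /\ pair_free a.
Proof.
have [n] := ubnP (size s); elim: n s => // n IH s les.
have [[v [t st]]|free] := pselect (exists v t, perm_eq s [:: v, - v & t]); last first.
  by exists s, [::]; rewrite cats0; split=> // v t st; apply: free; exists v, t.
have [|a [b [tab free]]] := IH t; first by move: les; rewrite (perm_size st) /=; lia.
exists a, (v :: b); split=> //; apply: (perm_trans st).
apply/permP => p; move/permP/(_ p): tab; rewrite /= !count_cat /= !count_cat /=; lia.
Qed.

Lemma pair_free_rem (s : seq int) (v : int) : pair_free s -> v \in s -> - v \notin rem v s.
Proof.
move=> free sv; apply/negP => /perm_to_rem st; apply: (free v (rem (- v) (rem v s))).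
by apply: (perm_trans (perm_to_rem sv)); rewrite perm_cons.
Qed.

Lemma pair_free_count_neq0 (s : seq int) (v : int) : pair_free s -> v != 0 ->
  count_mem v s = 0%N \/ count_mem (- v) s = 0%N.
Proof.
move=> free v0; have [sv|nsv] := boolP (v \in s); last by left; apply/count_memPn.
right; apply/count_memPn; have := pair_free_rem free sv.
apply: contra => snv; rewrite -has_pred1 has_count.
have := permP (perm_to_rem sv) (pred1 (- v)) => /=.
have -> : (v == - v) = false by lia.
by rewrite add0n => <-; rewrite -has_count has_pred1.
Qed.

Lemma pair_free_count0 (s : seq int) : pair_free s -> (count_mem 0%R s <= 1)%N.
Proof.
move=> free; have [s0|ns0] := boolP (0 \in s); last by rewrite (count_memPn ns0).
have := pair_free_rem free s0; rewrite oppr0 => /count_memPn c0.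
by rewrite (permP (perm_to_rem s0)) /= c0.
Qed.

Lemma odd_equiv_count (s t : seq int) : odd_equiv s t ->
  forall v : int, (count_mem v s + count_mem (- v) t = count_mem (- v) s + count_mem v t)%N.
Proof.
move=> /permP st v; move: (st (pred1 v)); rewrite !count_cat !count_map.
have opp (u : seq int) : count (preim -%R (pred1 v)) u = count_mem (- v) u.
  by apply: eq_count => w /=; rewrite eqr_oppLR.
by rewrite !opp.
Qed.

(* Counting v and -v determines the multiplicity of every v != 0;
   that of 0 is then fixed by the parity. *)
Lemma pair_free_perm_eq (s t : seq int) :
  pair_free s -> pair_free t -> odd (size s) = odd (size t) ->
  (forall v : int, (count_mem v s + count_mem (- v) t = count_mem (- v) s + count_mem v t)%N) ->
  perm_eq s t.
Proof.
move=> frees freet par cnt.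
have eqn0 (v : int) : v != 0 -> count_mem v s = count_mem v t.
  move=> v0; have := cnt v.
  by case: (pair_free_count_neq0 frees v0); case: (pair_free_count_neq0 freet v0);
    move: (count_mem v s) (count_mem v t) (count_mem (- v) s) (count_mem (- v) t); lia.
have /perm_size eqsz : perm_eq (seq.filter (predC1 0) s) (seq.filter (predC1 0) t).
  apply/allP => v _ /=; rewrite !count_filter.
  have [->|v0] := eqVneq v 0.
    by rewrite !(@eq_count _ _ pred0) ?count_pred0 // => w /=; case: (w == 0).
  rewrite !(@eq_count _ (predI (pred1 v) _) (pred1 v)) ?eqn0 // => w /=;
  by case: eqP => // ->; rewrite v0.
apply/allP => v _ /=; have [->|v0] := eqVneq v 0; last by rewrite eqn0.
have aux (c d m : nat) : odd (c + m) = odd (d + m) -> (c <= 1)%N -> (d <= 1)%N -> c = d.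
  by rewrite !oddD; case: c => [|[|?]]; case: d => [|[|?]] //=; case: (odd m).
apply/eqP/(aux _ _ (count (predC1 0) t)); try exact: pair_free_count0.
by rewrite !size_filter in eqsz; rewrite -{1}eqsz !count_predC.
Qed.

(** Deleting opposite pairs lowers the multiplicities of v and -v equally and keeps the parity of
    the length, so the counting relation passes to the cores. *)
Lemma odd_equiv_cores (s t a b a' b' : seq int) :
  size s = size t -> odd_equiv s t -> pair_free a -> pair_free a' ->
  perm_eq s (a ++ b ++ map -%R b) -> perm_eq t (a' ++ b' ++ map -%R b') ->
  perm_eq a a'.
Proof.
move=> szst /odd_equiv_count cnt freea freea' sab tab.
apply: pair_free_perm_eq => //.
  move: szst; rewrite (perm_size sab) (perm_size tab) !size_cat !size_map.
  by move/(congr1 odd); rewrite !oddD !addbb !addbF.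
have opp (v : int) (u : seq int) : count_mem v (map -%R u) = count_mem (- v) u.
  by rewrite count_map; apply: eq_count => w /=; rewrite eqr_oppLR.
move=> v; have := cnt v; rewrite !(permP sab) !(permP tab) !count_cat !opp opprK.
move: (count_mem v a) (count_mem v a') (count_mem (- v) a) (count_mem (- v) a').
move: (count_mem v b) (count_mem v b') (count_mem (- v) b) (count_mem (- v) b'); lia.
Qed.

(** An opposite pair occupies two distinct indices and gives a zero factor. Hence a solution with
    D(x) nonzero is its own core. *)
Lemma pair_free_of_pair_sum_prod (n : nat) (x : 'I_n -> int) :
  pair_sum_prod x != 0 -> pair_free (codom x).
Proof.
move=> Dx v t st; move: Dx.
have /codomP[i vi] : v \in codom x by rewrite (perm_mem st) inE eqxx.
have : perm_eq [:: v & map x (rem i (enum 'I_n))] [:: v, - v & t].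
  rewrite perm_sym (perm_trans _ (_ : perm_eq (codom x) _)) 1?perm_sym // codomE vi.
  by rewrite perm_sym -map_cons perm_map // perm_to_rem // mem_enum.
rewrite perm_cons => /perm_mem /(_ (- v)); rewrite inE eqxx => /mapP[j].
rewrite mem_rem_uniq ?enum_uniq // inE => /andP[ji _] vj.
by rewrite /pair_sum_prod (bigD1 i) //= (bigD1 j) //= -vi -vj subrr !mul0r eqxx.
Qed.

(** * Counting the tuples with a given core *)

Definition box_seq (n P : nat) (y : {ffun 'I_n -> 'I_(2 * P).+1}) : seq int :=
  codom (fun i => box_int (y i)).

Lemma size_box_seq n P (y : {ffun 'I_n -> 'I_(2 * P).+1}) : size (box_seq y) = n.
Proof. by rewrite size_codom card_ord. Qed.

Lemma box_seq_inj n P : injective (@box_seq n P).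
Proof.
move=> y y' /eq_in_map eqy; apply/ffunP => i.
by apply: (@box_int_inj P); apply: eqy; rewrite mem_enum.
Qed.

Lemma box_seq_le n P (y : {ffun 'I_n -> 'I_(2 * P).+1}) (v : int) :
  v \in box_seq y -> `|v| <= P%:Z.
Proof. by move=> /codomP[i ->]; apply/box_intP; exists (y i). Qed.

Lemma box_seq_surj n P (s : seq int) :
  size s = n -> (forall v : int, v \in s -> `|v| <= P%:Z) ->
  exists y : {ffun 'I_n -> 'I_(2 * P).+1}, box_seq y = s.
Proof.
move=> sn les.
have /fin_all_exists[u Hu] (i : 'I_n) : exists t : 'I_(2 * P).+1, nth 0 s i = box_int t.
  by apply/box_intP/les/mem_nth; rewrite sn.
exists (finfun u); rewrite /box_seq codomE -[RHS](mkseq_nth 0) sn /mkseq -val_enum_ord -map_comp.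
by apply: eq_map => i /=; rewrite ffunE Hu.
Qed.

Lemma box_seq_sum n P (y : {ffun 'I_n -> 'I_(2 * P).+1}) l :
  \sum_(v <- box_seq y) v ^+ l = \sum_i box_int (y i) ^+ l.
Proof. by rewrite big_map big_enum. Qed.

Lemma sum_odd_pairs (a b : seq int) l : odd l ->
  \sum_(v <- a ++ b ++ map -%R b) v ^+ l = \sum_(v <- a) v ^+ l.
Proof.
move=> oddl; rewrite !big_cat /= big_map -big_split [X in _ + X]big1 ?addr0 // => v _ /=.
by rewrite exprNn -signr_odd oddl mulN1r subrr.
Qed.

(** A member of [S] is fixed by one of [n!] arrangements and one of [(2P + 1)^m] lists [b]. *)
Lemma card_core_class_le n P m (a : seq int) (S : {set {ffun 'I_n -> 'I_(2 * P).+1}}) :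
  (forall y, y \in S -> exists2 b : seq int, size b = m &
     perm_eq (box_seq y) (a ++ b ++ map -%R b)) ->
  (#|S| <= n`! * (2 * P).+1 ^ m)%N.
Proof.
move=> HS.
have -> : (n`! * (2 * P).+1 ^ m)%N =
    size [seq [seq nth 0 (a ++ box_seq b ++ map -%R (box_seq b)) i | i <- Is] |
      Is <- permutations (iota 0 n), b <- enum {ffun 'I_m -> 'I_(2 * P).+1}].
  rewrite size_allpairs size_permutations ?iota_uniq // size_iota.
  by rewrite -cardE card_ffun !card_ord.
rewrite cardE -(size_map (@box_seq n P)) uniq_leq_size //.
  by rewrite (map_inj_uniq (@box_seq_inj n P)) enum_uniq.
move=> _ /mapP[y yS ->]; rewrite mem_enum in yS.
have [b sb yab] := HS y yS.
have [|b' eb'] := @box_seq_surj m P b sb.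
  by move=> v vb; apply: (@box_seq_le _ _ y); rewrite (perm_mem yab) !mem_cat vb orbT.
have sz : size (a ++ b ++ map -%R b) = n by rewrite -(perm_size yab) size_box_seq.
have /(perm_iotaP 0)[Is permIs ->] := yab.
apply/allpairsP; exists (Is, b'); split => //=.
- by rewrite mem_permutations -[X in iota 0 X]sz.
- by rewrite mem_enum.
- by rewrite eb'.
Qed.

(** Distinct lists [b] give distinct tuples even in the fixed order [a], [b], [-b]. *)
Lemma card_core_class_ge n P m (a : seq int) (S : {set {ffun 'I_n -> 'I_(2 * P).+1}}) :
  (size a + (m + m) = n)%N -> (forall v : int, v \in a -> `|v| <= P%:Z) ->
  (forall y b, box_seq y = a ++ b ++ map -%R b -> y \in S) ->
  ((2 * P).+1 ^ m <= #|S|)%N.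
Proof.
move=> szn lea HS.
have /fin_all_exists[u Hu] (b : {ffun 'I_m -> 'I_(2 * P).+1}) :
    exists y : {ffun 'I_n -> 'I_(2 * P).+1},
      box_seq y = a ++ box_seq b ++ map -%R (box_seq b).
  apply: box_seq_surj => [|v]; first by rewrite !size_cat (size_map -%R) !size_box_seq.
  rewrite !mem_cat => /or3P[/lea //|/box_seq_le //|/mapP[w wb ->]].
  by rewrite normrN; exact: (box_seq_le wb).
have u_inj : injective u.
  move=> b b' eqb; apply: box_seq_inj; have := Hu b; rewrite eqb Hu => /eqP.
  by rewrite eqseq_cat // eqxx /= eqseq_cat ?size_box_seq // => /andP[/eqP].
have -> : ((2 * P).+1 ^ m)%N = #|[set u b | b : {ffun 'I_m -> 'I_(2 * P).+1}]|.
  by rewrite card_imset // card_ffun !card_ord.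
by apply: subset_leq_card; apply/fintype.subsetP => _ /imsetP[b _ ->]; exact: HS (Hu b).
Qed.

(** * Counting the tuples with a given nonzero D *)

Lemma pair_sum_dvd n (x : 'I_n -> int) i j : i != j ->
  (`|(x i + x j)%R| %| `|pair_sum_prod x|)%N.
Proof.
move=> ij; rewrite /pair_sum_prod (bigD1 i) //= (bigD1 j) 1?eq_sym //=.
by rewrite !abszM -mulnA dvdn_mulr.
Qed.

Lemma pair_sum_prod_le n P (y : {ffun 'I_n -> 'I_(2 * P).+1}) : (0 < P)%N ->
  (`|pair_sum_prod (fun i => box_int (y i))| <= (2 * P) ^ (n * n))%N.
Proof.
move=> P0; rewrite -lez_nat abszE -natz natrX /pair_sum_prod normr_prod.
have P1 : 1 <= (2 * P)%:R :> int by rewrite natz lez_nat muln_gt0.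
rewrite exprM -[X in _ <= _ ^+ X]card_ord -prodr_const; apply: ler_prod => i _.
rewrite normr_ge0 normr_prod /=.
apply: (@le_trans _ _ (\prod_(j | j != i) (2 * P)%:R)).
  apply: ler_prod => j _; rewrite normr_ge0 /= (le_trans (ler_normD _ _)) //.
  by rewrite natz [X in _ <= Posz X]mul2n -addnn PoszD lerD //;
    apply/box_intP; [exists (y i)|exists (y j)].
(* Fewer than [n] factors occur here; the exponent may be raised to [n] since [2P >= 1]. *)
rewrite prodr_const ler_weXn2l // -[X in (_ <= X)%N]card_ord.
by apply: subset_leq_card; exact/fintype.subsetP.
Qed.

Lemma card_signed_divisors (Q N : nat) : (0 < N)%N ->
  (#|[set v : 'I_(2 * Q).+1 | `|v%:Z - Q%:Z| %| N]%N| <= 2 * size (divisors N))%N.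
Proof.
move=> N0; rewrite cardE -(size_map (fun v : 'I_(2 * Q).+1 => v%:Z - Q%:Z)).
have -> : (2 * size (divisors N))%N =
    size (map Posz (divisors N) ++ map (fun d => - Posz d) (divisors N)).
  by rewrite size_cat !size_map addnn mul2n.
apply: uniq_leq_size.
  by rewrite map_inj_uniq ?enum_uniq //; exact: (@box_int_inj Q).
move=> _ /mapP[v vA ->]; rewrite mem_enum inE dvdn_divisors // in vA.
rewrite mem_cat; apply/orP; case: (lerP 0 (v%:Z - Q%:Z)) => [ge0|lt0].
  by left; rewrite -[X in X \in _]gez0_abs //; apply: map_f.
by right; apply/mapP; exists `|v%:Z - Q%:Z|%N => //; rewrite ltz0_abs // opprK.
Qed.

(* The sums y_0 + y_j (j > 0) and y_1 + y_2 determine y, and each of them divides the product. *)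
Lemma card_pair_sum_prod_eq n P (N : nat) (S : {set {ffun 'I_n.+3 -> 'I_(2 * P).+1}}) :
  (0 < N)%N ->
  (forall y, y \in S -> `|pair_sum_prod (fun i => box_int (y i))|%N = N) ->
  (#|S| <= (2 * size (divisors N)) ^ n.+3)%N.
Proof.
move=> N0 HS.
pose j1 : 'I_n.+3 := lift ord0 ord0; pose j2 : 'I_n.+3 := lift ord0 (lift ord0 ord0).
pose a (j : 'I_n.+3) : 'I_n.+3 := if j == ord0 then j1 else ord0.
pose b (j : 'I_n.+3) : 'I_n.+3 := if j == ord0 then j2 else j.
have ab j : a j != b j by rewrite /a /b; case: (eqVneq j ord0) => // j0; rewrite eq_sym.
(* The offsets [P] add up, so the sum of two codes is the code of the sum in the box [[-2P, 2P]]. *)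
pose f (y : {ffun 'I_n.+3 -> 'I_(2 * P).+1}) :=
  [ffun j => inord (y (a j) + y (b j)) : 'I_(2 * (2 * P)).+1].
have fE y j : f y j = (y (a j) + y (b j))%N :> nat.
  rewrite ffunE inordK // ltnS.
  by move: (ltn_ord (y (a j))) (ltn_ord (y (b j))); lia.
have f_inj : injective f.
  move=> y y' eqf.
  have eqs j : (y (a j) + y (b j) = y' (a j) + y' (b j))%N by rewrite -!fE eqf.
  have y0 : y ord0 = y' ord0 :> nat.
    move: (eqs ord0) (eqs j1) (eqs j2); rewrite /a /b /=; lia.
  apply/ffunP => j; apply: val_inj => /=.
  have [->//|j0] := eqVneq j ord0.
  by move: (eqs j); rewrite /a /b (negbTE j0) y0 => /addnI.
rewrite -(card_imset _ f_inj).
pose A := [set v : 'I_(2 * (2 * P)).+1 | `|v%:Z - (2 * P)%:Z| %| N]%N.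
have sub : f @: S \subset ffun_on (mem A).
  apply/fintype.subsetP => _ /imsetP[y yS ->]; apply/ffun_onP => j.
  rewrite inE fE -(HS y yS).
  have := pair_sum_dvd (fun i => box_int (y i)) (ab j).
  by congr (`|_| %| _)%N; rewrite /box_int PoszM PoszD; ring.
apply: leq_trans (subset_leq_card sub) _.
rewrite card_ffun_on card_ord leq_exp2r //.
exact: card_signed_divisors.
Qed.

Lemma leq_expnDl M a b : ((a + b) ^ M <= 2 ^ M * (a ^ M + b ^ M))%N.
Proof.
have le_exp u v : (u <= v -> u ^ M <= v ^ M)%N.
  by case: M => // M' uv; rewrite leq_exp2r.
apply: (@leq_trans ((2 * maxn a b) ^ M)).
  by apply: le_exp; rewrite mul2n -addnn leq_add ?leq_maxl ?leq_maxr.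
by rewrite expnMn leq_mul //; case: (leqP a b) => _; rewrite ?leq_addl ?leq_addr.
Qed.

(** * The dichotomy for the number of solutions *)

Definition solutions (s k P : nat) (h : 'I_k -> int) :=
  [set x : {ffun 'I_s -> 'I_(2 * P).+1} |
    [forall j : 'I_k, \sum_(i < s) box_int (x i) ^+ (2 * j).+1 == h j]].

Lemma solutionsP s k P (h : 'I_k -> int) (x : {ffun 'I_s -> 'I_(2 * P).+1}) :
  reflect (forall j : 'I_k, \sum_(v <- box_seq x) v ^+ (2 * j).+1 = h j)
    (x \in solutions s P h).
Proof.
rewrite inE; apply: (iffP forallP) => H j; first by rewrite box_seq_sum; apply/eqP.
by apply/eqP; rewrite -box_seq_sum.
Qed.

Lemma solutions_odd_equiv_or k P (h : 'I_k -> int)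
    (x y : {ffun 'I_k.+1 -> 'I_(2 * P).+1}) :
  x \in solutions k.+1 P h -> y \in solutions k.+1 P h ->
  let D (u : {ffun 'I_k.+1 -> 'I_(2 * P).+1}) :=
    pair_sum_prod (fun i => box_int (u i)) in
  odd_equiv (box_seq x) (box_seq y) \/
  [/\ D x != 0, D y != 0 & `|D x| = `|D y|].
Proof.
move=> /solutionsP Hx /solutionsP Hy; apply: odd_equiv_or_pair_sum_prod => j ltj.
by rewrite -!box_seq_sum (Hx (Ordinal ltj)) (Hy (Ordinal ltj)).
Qed.

Lemma odd_equiv_perm_core n P (a b : seq int)
    (x y : {ffun 'I_n -> 'I_(2 * P).+1}) :
  pair_free a -> perm_eq (box_seq x) (a ++ b ++ map -%R b) ->
  odd_equiv (box_seq x) (box_seq y) ->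
  exists2 b' : seq int, size b' = size b &
    perm_eq (box_seq y) (a ++ b' ++ map -%R b').
Proof.
move=> freea xab xy.
have [a' [b' [yab freea']]] := pair_free_decomposition (box_seq y).
have szxy : size (box_seq x) = size (box_seq y) by rewrite !size_box_seq.
have aa' := odd_equiv_cores szxy xy freea freea' xab yab.
exists b'; last by rewrite (perm_trans yab) // perm_cat2r perm_sym.
move: szxy; rewrite (perm_size xab) (perm_size yab) !size_cat !(size_map -%R) (perm_size aa').
by move: (size a') (size b) (size b'); lia.
Qed.

(** Solutions odd-equivalent to [x] share its core, which is all of [x], so they are rearrangements
    of it; every other solution has [|D| = N]. *)
Lemma U_le_of_pair_sum_prod_neq0 k P (h : 'I_k.+2 -> int)
    (x : {ffun 'I_k.+3 -> 'I_(2 * P).+1}) :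
  x \in solutions k.+3 P h ->
  let N := `|pair_sum_prod (fun i => box_int (x i))|%N in
  (0 < N)%N ->
  (U k.+3 P h <= k.+3`! + (2 * size (divisors N)) ^ k.+3)%N.
Proof.
move=> xS N N0; rewrite /U -/(solutions k.+3 P h).
pose S1 := [set y in solutions k.+3 P h | odd_equiv (box_seq x) (box_seq y)].
rewrite -(cardsID S1) leq_add //.
  apply: (@leq_trans (k.+3`! * (2 * P).+1 ^ 0)); last by rewrite muln1.
  apply: (@card_core_class_le _ _ _ (box_seq x)) => y; rewrite !inE => /and3P[_ _ xy].
  have freex : pair_free (box_seq x).
    by apply: pair_free_of_pair_sum_prod; rewrite -absz_eq0 -lt0n.
  by have [|b sb yb] := @odd_equiv_perm_core _ P _ [::] x y freex _ xy;
    [rewrite cats0 | exists b].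
apply: card_pair_sum_prod_eq => // y /setDP[yS nyS1].
case: (solutions_odd_equiv_or xS yS) => [xy|[_ _ eqD]].
  by rewrite [y \in S1]inE xy yS in nyS1.
by apply/eqP; rewrite -eqz_nat !abszE eqD.
Qed.

(** Since [D(x) = 0], every solution is odd-equivalent to [x] and shares its core [a]. Conversely,
    opposite pairs cancel in odd power sums, so any [b] in the box completes [a] to a solution. *)
Lemma U_core_bounds k P (h : 'I_k -> int) (x : {ffun 'I_k.+1 -> 'I_(2 * P).+1}) :
  x \in solutions k.+1 P h ->
  pair_sum_prod (fun i => box_int (x i)) = 0 ->
  exists (m : nat) (a : seq int),
    [/\ (size a + (m + m) = k.+1)%N,
        (forall v : int, v \in a -> `|v| <= P%:Z),
        (forall j : 'I_k, h j = \sum_(v <- a) v ^+ (2 * j).+1) &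
        ((2 * P).+1 ^ m <= U k.+1 P h <= k.+1`! * (2 * P).+1 ^ m)%N].
Proof.
move=> xS Dx0; have [a [b [xab freea]]] := pair_free_decomposition (box_seq x).
have sza : (size a + (size b + size b) = k.+1)%N.
  by rewrite -(@size_box_seq _ _ x) (perm_size xab) !size_cat (size_map -%R).
have lea v : v \in a -> `|v| <= P%:Z.
  by move=> va; apply: (@box_seq_le _ _ x); rewrite (perm_mem xab) mem_cat va.
have Hh j : h j = \sum_(v <- a) v ^+ (2 * j).+1.
  rewrite -(solutionsP _ _ xS) (perm_big _ xab) /= sum_odd_pairs //.
  by rewrite mul2n /= odd_double.
exists (size b), a; split=> //; rewrite /U -/(solutions k.+1 P h); apply/andP; split.
  apply: (card_core_class_ge sza lea) => y b' yab; apply/solutionsP => j.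
  by rewrite yab sum_odd_pairs ?Hh //= mul2n odd_double.
apply: (@card_core_class_le _ _ _ a) => y yS.
case: (solutions_odd_equiv_or xS yS) => [xy|[]]; last by rewrite Dx0 eqxx.
exact: (odd_equiv_perm_core freea xab xy).
Qed.

(** The first alternative reads U = O(P^(1/M)) without roots; it arises when the chosen solution has
    D nonzero. *)
Lemma U_dichotomy (k M : nat) : (2 <= k)%N ->
  exists2 B : nat, (0 < B)%N & forall (P : nat) (h : 'I_k -> int),
    (0 < P)%N -> (0 < U k.+1 P h)%N ->
    (U k.+1 P h ^ M <= B * P)%N \/
    exists (m : nat) (a : seq int),
    [/\ (size a + (m + m) = k.+1)%N,
        (forall v : int, v \in a -> `|v| <= P%:Z),
        (forall j : 'I_k, h j = \sum_(v <- a) v ^+ (2 * j).+1) &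
        ((2 * P).+1 ^ m <= U k.+1 P h <= k.+1`! * (2 * P).+1 ^ m)%N].
Proof.
(* [k >= 2] provides the three variables needed to recover a tuple from its pair sums. *)
case: k => [|[|k]] // _.
(* With n = [k.+3] variables, [N <= (2P)^(n^2)]; the factor [n^2] in the exponent undoes this power
   and leaves [d(N)^(nM) <= 2 * B0 * P]. *)
have [B0 B0_gt0 HB0] := divisors_bound (k.+3 * M * (k.+3 * k.+3)).
exists (2 ^ M * (k.+3`! ^ M + 2 ^ (k.+3 * M) * (B0 * 2)))%N.
  by rewrite muln_gt0 addn_gt0 !expn_gt0 ?fact_gt0.
move=> P h P0 U0; have [x xS] : exists x, x \in solutions k.+3 P h by apply/card_gt0P.
have [Dx0|Dx0] := eqVneq (pair_sum_prod (fun i => box_int (x i))) 0.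
  by right; exact: (U_core_bounds xS Dx0).
left; set N := `|pair_sum_prod (fun i => box_int (x i))|%N.
have N0 : (0 < N)%N by rewrite lt0n absz_eq0.
have le_exp u v e : (u <= v -> u ^ e <= v ^ e)%N by case: e => // e uv; rewrite leq_exp2r.
apply: (leq_trans (le_exp _ _ M (U_le_of_pair_sum_prod_neq0 xS N0))).
apply: (leq_trans (leq_expnDl _ _ _)); rewrite -mulnA leq_mul // mulnDl leq_add //.
  by rewrite leq_pmulr.
rewrite -expnM expnMn -mulnA leq_mul //.
rewrite -(@leq_exp2r _ _ (k.+3 * k.+3)) // -expnM.
apply: leq_trans (HB0 N N0) _.
apply: (@leq_trans (B0 * (2 * P) ^ (k.+3 * k.+3))).
  by rewrite leq_mul // pair_sum_prod_le.
by rewrite -mulnA [X in (_ <= X)%N]expnMn leq_mul // -[X in (X <= _)%N]expn1 leq_pexp2l.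
Qed.

(** * Comparison of real exponents and the final bounds *)

(** Here [c <= P^(1/M) <= P^eta], so [m <= r] would force [c * P^m <= P^(r + eta)]. *)
Lemma powR_natD_lt (R : realType) (P r m c M : nat) (eta : R) :
  0 < eta -> 1 <= eta * M%:R -> (c ^ M <= P)%N -> (0 < P)%N ->
  P%:R `^ (r%:R + eta) < (c * P ^ m)%:R :> R -> (r < m)%N.
Proof.
move=> eta0 etaM cM P0 lt; rewrite ltnNge; apply/negP => lemr.
have P1 : 1 <= P%:R :> R by rewrite ler1n.
move: lt; apply/negP; rewrite -leNgt.
have M0 : (0 < M)%N by rewrite lt0n; apply: contraTneq etaM => ->; rewrite mulr0 ler10.
rewrite powRD; last by apply/implyP => _; rewrite pnatr_eq0 -lt0n.
rewrite powR_mulrn // natrM natrX mulrC ler_pM ?exprn_ge0 //; first by rewrite ler_weXn2l.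
rewrite -(@ler_pXn2r _ M) ?nnegrE ?powR_ge0 //.
rewrite -[X in _ <= X]powR_mulrn ?powR_ge0 // -powRrM -natrX.
apply: (@le_trans _ _ P%:R); first by rewrite ler_nat.
by rewrite -[X in X <= _]powRr1 // ler_powR.
Qed.

Lemma sum_nth_pad (L : nat) (a : seq int) (l : nat) : (size a <= L)%N ->
  \sum_(i < L) nth 0 a i ^+ l.+1 = \sum_(v <- a) v ^+ l.+1.
Proof.
move=> leL; rewrite -(big_mkord predT (fun i => nth 0 a i ^+ l.+1)).
rewrite [RHS](big_nth 0) [LHS](@big_cat_nat _ _ _ (size a)) //= -[RHS]addr0.
congr (_ + _); rewrite big_nat big1 // => i /andP[lei _].
by rewrite nth_default // expr0n.
Qed.

Theorem theorem1p5 (R : realType) (k r : nat) (hk : (2 <= k)%N) :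
  exists (c : R) (C : R -> R),
    0 < c /\ (forall eps : R, 0 < eps -> 0 < C eps) /\
    forall eta : R, 0 < eta < 1 ->
    exists P0 : nat, forall P : nat, (P0 <= P)%N ->
    forall h : 'I_k -> int,
      P%:R `^ (r%:R + eta) < (U k.+1 P h)%:R :> R ->
      ((2 * r <= k - 1)%N /\
       exists a : 'I_(k - 1 - 2 * r) -> int,
         (forall i, `|a i| <= P%:Z) /\
         forall j : 'I_k,
           h j = \sum_(i < k - 1 - 2 * r) a i ^+ (2 * j).+1) /\
      ((forall r' : nat,
          P%:R `^ (r'%:R + eta) < (U k.+1 P h)%:R :> R -> (r' <= r)%N) ->
       c * P%:R ^+ r.+1 <= (U k.+1 P h)%:R /\
       forall eps : R, 0 < eps ->
         (U k.+1 P h)%:R <= C eps * P%:R `^ (r%:R + 1 + eps)).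
Proof.
(* From [2P + 1 <= 3P] and [m <= k + 1]; the resulting bound [c * P^m] serves for every [eps]. *)
pose c := (k.+1`! * 3 ^ k.+1)%N.
have c0 : (0 < c)%N by rewrite muln_gt0 fact_gt0 expn_gt0.
exists 1, (fun=> c%:R); split=> //; split=> [eps _|eta /andP[eta0 eta1]].
  by rewrite ltr0n.
(* [eta * M >= 2] makes [U^M > P^2], which excludes the first alternative once [P > B]. *)
pose M := Num.bound (2 / eta).
have etaM : 2 <= eta * M%:R.
  rewrite mulrC -ler_pdivrMr // ltW // archi_boundP //.
  by rewrite divr_ge0 // ltW.
have [B B0 HB] := U_dichotomy M hk.
(* [P > B] gives [B * P < P^2], and [P > c^M] lets [P^eta] absorb the constant [c]. *)
exists (maxn B (c ^ M)).+1 => P; rewrite gtn_max => /andP[ltB ltc] h ltU.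
have P0 : (0 < P)%N by apply: leq_trans ltB.
have P1 : 1 <= P%:R :> R by rewrite ler1n.
have U0 : (0 < U k.+1 P h)%N.
  by rewrite -(ltr0n R); apply: le_lt_trans ltU; exact: powR_ge0.
have [|[m [a [sza lea Hh /andP[lowU upU]]]]] := HB P h P0 U0.
  rewrite leqNgt => /negP[]; apply: (@ltn_trans (P * P)); first by rewrite ltn_pmul2r.
  rewrite -(ltr_nat R) natrM natrX -expr2.
  apply: (@le_lt_trans _ _ ((P%:R `^ (r%:R + eta)) ^+ M)).
    rewrite -[X in X <= _]powR_mulrn // -[X in _ <= X]powR_mulrn ?powR_ge0 // -powRrM.
    by rewrite ler_powR // (le_trans etaM) // ler_wpM2r // lerDr.
  by rewrite ltrXn2r ?powR_ge0.
have upU' : (U k.+1 P h <= c * P ^ m)%N.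
  apply: leq_trans upU _; rewrite /c -mulnA leq_mul2l; apply/orP; right.
  apply: (@leq_trans ((3 * P) ^ m)).
    by case: (m) => // ?; rewrite leq_exp2r //; lia.
  by rewrite expnMn leq_mul // leq_pexp2l //; lia.
have ltrm : (r < m)%N.
  apply: (@powR_natD_lt R P r m c M eta) => //.
  - by apply: le_trans etaM; rewrite ler1n.
  - exact: ltnW.
  - by apply: lt_le_trans ltU _; rewrite ler_nat.
split.
  have le2r : (2 * r <= k - 1)%N by lia.
  (* The core has [k + 1 - 2m <= k - 1 - 2r] entries as [r < m]; the default 0 of [nth] fills the
     remaining places. *)
  split=> //; exists (fun i => nth 0 a i); split=> [i|j].
    have [lti|gei] := ltnP i (size a); first by apply: lea; exact: mem_nth.
    by rewrite nth_default // normr0.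
  by rewrite sum_nth_pad ?Hh //; lia.
(* As [eta < 1], [U >= (2P + 1)^m > P^m >= P^(m - 1 + eta)], so maximality of [r] yields
   [m - 1 <= r]. *)
move=> maxr; have eqm : r.+1 = m.
  apply/eqP; rewrite eqn_leq ltrm /= -[X in (X <= _)%N](@prednK m) 1?(leq_trans _ ltrm) // ltnS.
  apply: maxr; apply: (@lt_le_trans _ _ ((2 * P).+1 ^ m)%:R); last by rewrite ler_nat.
  apply: (@le_lt_trans _ _ (P ^ m)%:R); last first.
    by rewrite ltr_nat ltn_exp2r ?(leq_trans _ ltrm) //; lia.
  rewrite natrX -powR_mulrn // ler_powR // -{2}(@prednK m) ?(leq_trans _ ltrm) //.
  by rewrite -[X in _ <= X]natr1 lerD2l ltW.
rewrite eqm; split=> [|eps eps0].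
  rewrite mul1r -natrX ler_nat; apply: leq_trans lowU.
  by case: (m) => // ?; rewrite leq_exp2r //; lia.
apply: (@le_trans _ _ (c * P ^ m)%:R); first by rewrite ler_nat.
rewrite natrM natrX -powR_mulrn // ler_wpM2l // ler_powR //.
by rewrite natr1 eqm lerDl ltW.
Qed.
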